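(* There exists an absolute constant $K>0$ such that for every $n\ge 1$ and every connected graph $G$ on $n$ vertices, the probabilistic throttling number of $G$ satisfies $\mathrm{th}_{\mathrm{pzf}}(G)\le K\sqrt{n}$.
   Context: Graphs are finite and simple. Probabilistic zero forcing on a graph $G=(V,E)$: every vertex is blue or white; start from a nonempty set $S\subseteq V$ of blue vertices, all others being white. At each time step, if $B$ is the current set of blue vertices, every $u\in B$ attempts to force each of its white neighbors $v$ to become blue, independently (over all such pairs $(u,v)$, and over time given the current blue set), with success probability $\mathbb{P}(u\to v)=\frac{|N[u]\cap B|}{\deg(u)}$, where $N[u]$ is the closed neighborhood of $u$ (the vertex $u$ together with its neighbors). A white vertex becomes blue if at least one attempt on it succeeds; blue vertices remain blue. The propagation time $\mathrm{pt}_{\mathrm{pzf}}(G,S)$ is the random number of steps until all vertices of $G$ are blue starting from initial blue set $S$, and $\mathrm{ept}(G,S)=\mathbb{E}[\mathrm{pt}_{\mathrm{pzf}}(G,S)]$. The probabilistic throttling number is $\mathrm{th}_{\mathrm{pzf}}(G)=\min_{\emptyset\neq S\subseteq V}\{|S|+\mathrm{ept}(G,S)\}$. *)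

(* Defs.v *)
From mathcomp Require Import all_boot all_order all_algebra.
From mathcomp Require Import all_classical all_reals all_analysis.
From mathcomp Require Import measurable_realfun.

Set Implicit Arguments.
Unset Strict Implicit.
Unset Printing Implicit Defensive.

Import Order.TTheory GRing.Theory Num.Theory.
Import numFieldNormedType.Exports.

Local Open Scope ring_scope.

Definition connected_graph (T : finType) (e : rel T) : Prop :=
  forall x y : T, connect e x y.

Section ProbabilisticZeroForcing.
Variables (R : realType) (T : finType) (e : rel T).

Definition nbhd (u : T) : {set T} := [set v | e u v].

Definition closed_nbhd (u : T) : {set T} := u |: nbhd u.

Definition deg (u : T) : nat := #|nbhd u|.

Definition force_prob (B : {set T}) (u : T) : R :=
  #|closed_nbhd u :&: B|%:R / (deg u)%:R.

Definition attempts (B : {set T}) : {set T * T} :=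
  [set uv | [&& uv.1 \in B, uv.2 \notin B & e uv.1 uv.2]].

(* Independent attempts: the probability that [A] is exactly the set of
   successful attempts, for [A \subset attempts B]. *)
Definition success_prob (B : {set T}) (A : {set T * T}) : R :=
  (\prod_(uv in A) force_prob B uv.1) *
  (\prod_(uv in attempts B :\: A) (1 - force_prob B uv.1)).

Definition next_blue (B : {set T}) (A : {set T * T}) : {set T} :=
  B :|: [set uv.2 | uv in A].

Definition step_prob (B B' : {set T}) : R :=
  \sum_(A in powerset (attempts B) | next_blue B A == B') success_prob B A.

(* The probability that the blue sets at times 0, ..., t are x 0, ..., x t. *)
Definition traj_prob (S : {set T}) (t : nat) (x : {ffun 'I_t.+1 -> {set T}}) :
    R :=
  (x ord0 == S)%:R *
  \prod_(i < t) step_prob (x (widen_ord (leqnSn t) i)) (x (lift ord0 i)).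

Definition first_full (t : nat) (x : {ffun 'I_t.+1 -> {set T}}) : bool :=
  (x ord_max == [set: T]) && [forall i : 'I_t.+1, (i < t)%N ==> (x i != [set: T])].

(* P(pt = t) *)
Definition pt_pmf (S : {set T}) (t : nat) : R :=
  \sum_(x : {ffun 'I_t.+1 -> {set T}} | first_full x) traj_prob S x.

Local Open Scope ereal_scope.

(* The propagation time is +oo on the event that the graph never turns entirely
   blue, so the probability of that event carries the value +oo; recall that
   +oo * 0 = 0.  See [ept_processE] for the expectation on an arbitrary
   probability space. *)
Definition ept (S : {set T}) : \bar R :=
  \sum_(0 <= t <oo) t%:R%:E * (pt_pmf S t)%:E +
  +oo * (1 - \sum_(0 <= t <oo) (pt_pmf S t)%:E).

(* For inhabited [T] the range is nonempty, so this is the minimum over the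
   nonempty sets S. *)
Definition th_pzf : \bar R :=
  \big[Order.min/+oo]_(S : {set T} | S != finset.set0) (#|S|%:R%:E + ept S).

End ProbabilisticZeroForcing.

Section Process.
Local Open Scope classical_set_scope.
Local Open Scope ereal_scope.

Definition pzf_process (R : realType) (T : finType) (e : rel T) (S : {set T})
    (d : measure_display) (Omega : measurableType d) (P : probability Omega R)
    (X : nat -> Omega -> {set T}) : Prop :=
  (forall t (B : {set T}), measurable (X t @^-1` [set B])) /\
  (forall t (x : {ffun 'I_t.+1 -> {set T}}),
     P [set w | forall i : 'I_t.+1, X i w = x i] = (traj_prob R e S x)%:E).

Definition prop_time (R : realType) (T : finType) (Omega : Type)
    (X : nat -> Omega -> {set T}) (w : Omega) : \bar R :=
  ereal_inf [set t%:R%:E | t in [set t | X t w = finset.setTfor T]].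

Lemma ept_processE (R : realType) (T : finType) (e : rel T) (S : {set T})
    (d : measure_display) (Omega : measurableType d) (P : probability Omega R)
    (X : nat -> Omega -> {set T}) :
  pzf_process e S P X -> \int[P]_w prop_time R X w = ept R e S.
Proof.
move=> [mX fddX].
pose cyl t (x : {ffun 'I_t.+1 -> {set T}}) :=
  [set w | forall i : 'I_t.+1, X i w = x i].
pose A t := [set w | X t w = finset.setTfor T /\
  forall s, (s < t)%N -> X s w <> finset.setTfor T].
have mcyl t x : measurable (@cyl t x).
  rewrite (_ : cyl t x = \bigcap_(i in [set: 'I_t.+1]) (X i @^-1` [set x i])).
    by apply: fin_bigcap_measurable => // i _; exact: mX.
  apply/seteqP; split => w /= xw i; first by move=> _; exact: xw.
  exact: (xw i I).
have AE t : A t = \bigcup_(x in [set` [pred x | @first_full T t x]]) cyl t x.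
  apply/seteqP; split => w /=.
    move=> [Xt Xs]; exists [ffun i : 'I_t.+1 => X i w]; last first.
      by move=> i; rewrite ffunE.
    rewrite /= inE /first_full ffunE /= Xt eqxx /=.
    by apply/forallP => i; apply/implyP => it; rewrite ffunE; apply/eqP/Xs.
  move=> [x /=]; rewrite inE => /andP[/eqP xT /forallP xs] cx; split.
    by rewrite -[LHS]/(X (@ord_max t) w) cx.
  move=> s st; have st' : (s < t.+1)%N by rewrite ltnS ltnW.
  rewrite -[X s]/(X (Ordinal st')) cx.
  by apply/eqP; exact: (implyP (xs (Ordinal st'))).
have mA t : measurable (A t).
  by rewrite AE; apply: fin_bigcup_measurable => // x _; exact: mcyl.
have PA t : P (A t) = (pt_pmf R e S t)%:E.
  rewrite AE measure_fin_bigcup//.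
    rewrite /pt_pmf -sumEFin -big_enum/= [RHS]fsbig_seq ?enum_uniq//.
    rewrite (_ : [set` enum _] = [set` [pred x | @first_full T t x]]).
      by apply: eq_fsbigr => x _; exact: fddX.
    by apply/seteqP; split => x /=; rewrite mem_enum.
  move=> x y _ _ [w [xw yw]]; apply/ffunP => i.
  by rewrite -xw -yw.
have tA : trivIset setT A.
  move=> s t _ _ [w [[Xs ltXs] [Xt ltXt]]].
  by case: (ltngtP s t) => // [/ltXt|/ltXs].
have tA' : P (\bigcup_t A t) = \sum_(0 <= t <oo) (pt_pmf R e S t)%:E.
  rewrite measure_semi_bigcup//; last exact: bigcup_measurable.
  by apply: eq_eseriesr => t _; exact: PA.
have ptA t : {in A t, prop_time R X =1 cst t%:R%:E}.
  move=> w; rewrite inE => -[Xt Xs] /=; apply/eqP; rewrite eq_le.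
  apply/andP; split; first by apply: ereal_inf_lbound; exists t.
  apply/ereal_infP => _ [s /= Xsw <-]; rewrite lee_fin ler_nat leqNgt.
  by apply/negP => /Xs.
have ptN : {in ~` (\bigcup_t A t), prop_time R X =1 cst +oo}.
  move=> w; rewrite inE => nA; apply/ereal_inf_pinfty => _ [t /= Xt <-].
  exfalso; apply: nA.
  have ex : exists t, X t w == finset.setTfor T by exists t; exact/eqP.
  exists (ex_minn ex) => //; case: ex_minnP => m /eqP Xm minm; split => //.
  by move=> s sm /eqP /minm; rewrite leqNgt sm.
have mU : measurable (\bigcup_t A t) by exact: bigcup_measurable.
have mptA : measurable_fun (\bigcup_t A t) (prop_time R X).
  apply/measurable_fun_bigcup => // t.
  apply: (@eq_measurable_fun _ _ _ _ _ (cst t%:R%:E)) => [w wA|].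
    by rewrite (ptA t).
  exact: measurable_cst.
have pt0 w : 0 <= prop_time R X w.
  by apply/ereal_infP => _ [t _ <-]; rewrite lee_fin.
rewrite -(setvU (\bigcup_t A t)) setUC ge0_integral_setU//=; first last.
- by apply/disj_setPS => w [].
- apply/measurable_funU => //; first exact: measurableC.
  split=> //; apply: (@eq_measurable_fun _ _ _ _ _ (cst +oo)) => [w wA|].
    by rewrite ptN.
  exact: measurable_cst.
- exact: measurableC.
rewrite ge0_integral_bigcup// /ept; congr (_ + _).
  apply: eq_eseriesr => t _.
  rewrite (@eq_integral _ _ _ _ _ (cst t%:R%:E)); last exact: ptA.
  by rewrite integral_cst//; congr (_ * _); exact: PA.
rewrite (@eq_integral _ _ _ _ _ (cst +oo)); last exact: ptN.
rewrite integral_cst; last exact: measurableC.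
by congr (_ * _); rewrite -tA'; exact: probability_setC.
Qed.
End Process.

(* Main.v *)
Require Import Defs.
From mathcomp Require Import all_boot all_order all_algebra.
From mathcomp Require Import all_classical all_reals all_analysis.
From mathcomp Require Import fintype finset ring lra zify.

Set Implicit Arguments.
Unset Strict Implicit.
Unset Printing Implicit Defensive.

Import Order.TTheory GRing.Theory Num.Theory.
Import numFieldNormedType.Exports.

Local Open Scope ring_scope.

(** A set S of O(sqrt n) vertices can be chosen so that every vertex is joined
to S by a path along which the colour spreads in O(sqrt n) steps, with a failure
probability that then decays geometrically and so survives a union bound over
the n vertices.

Choice of the blue set.  Let m be the least integer with n <= m ^ 2.  Around a
vertex v, take the ball of least radius k that has at least m vertices.  A
maximal family of pairwise disjoint such balls has at most n / m <= m members;
S is the set of their centres.  By maximality the ball of any vertex v meets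
the ball of some s in S, so v is joined to s by a path inside the two balls.
Give a vertex u the cost 2 (deg u + 1).  Along a path that climbs the layers
of a ball, deg u + 1 is at most the size of three consecutive layers, so the
product of the costs up to radius k - 2 is at most 2 to the power of three
times the size of a ball with fewer than m vertices; each of the two outermost
vertices costs at most 2 n <= 2 ^ (2 m + 1).  So the cost of the path from v to
s, the product of the costs of its vertices, is 2 ^ O(m) ([linked_set]).

Propagation along a path.  Let u be blue, with b blue vertices in its closed
neighbourhood, and let v be a white neighbour of u.  The quantity
2 (deg u + 1) / b, replaced by 1 as soon as v is blue, shrinks in one step, in
expectation, by the factor 37/40: if 2 b <= deg u, then u forces about b new
neighbours and b grows by a constant factor; otherwise u forces v with
probability at least 1/2 ([edge_potential_drift]).  On a path from a white
vertex x to S, apply this to the blue vertex nearest to x along the path, and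
multiply by the costs of the white vertices strictly between the two.  This
gives a potential that is at least 1 and has the same drift
([path_potential_drift]).

Conclusion.  The sum Phi of these potentials over the white vertices contracts
by 37/40 in expectation, is at least 1 while some vertex is white, and is
2 ^ O(m) at the start.  By concavity, (80 / 3) ln (1 + Phi) decreases by at
least 1 per step in expectation, so its initial value, which is O(m), bounds
the expected propagation time ([ept_le_drift], [ept_le_paths]). *)

(** * Independent attempts *)

Section IndependentWeights.
Variables (R : comNzRingType) (I : finType) (D : {set I}) (p : I -> R).

Definition indep_weight (A : {set I}) : R :=
  (\prod_(i in A) p i) * \prod_(i in D :\: A) (1 - p i).

(** Let [F] weigh success, vanishing outside [D], and [G] weigh failure,
vanishing on [C].  Expanding the product over [i] of [F i + G i] leaves exactly
the sets between [C] and [D]. *)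
Lemma sum_indep_weight_sup (C : {set I}) : C \subset D ->
  \sum_(A in powerset D | C \subset A) indep_weight A = \prod_(i in C) p i.
Proof.
move=> /subsetP CD.
pose F i := if i \in D then p i else 0.
pose G i := if i \in C then 0 else if i \in D then 1 - p i else 1.
transitivity (\prod_i (F i + G i)); last first.
  rewrite (bigID (mem C)) /= [X in _ * X]big1 ?mulr1.
    by apply: eq_bigr => i iC; rewrite /F /G iC CD // addr0.
  move=> i /negbTE iC; rewrite /F /G iC.
  by case: ifP => _; rewrite ?add0r // addrC subrK.
rewrite bigA_distr [RHS](bigID [pred J : {set I} | (J \in powerset D) && (C \subset J)]) /=.
rewrite [X in _ = _ + X]big1 ?addr0; last first.
  move=> J; rewrite powersetE negb_and => /orP[] /subsetPn[i iJ iD].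
    by rewrite (bigD1 i) //= iJ /F (negbTE iD) mul0r.
  by rewrite (bigD1 i) //= (negbTE iD) /G iJ mul0r.
apply: eq_bigr => A; rewrite powersetE => /andP[/subsetP AD /subsetP CA].
rewrite /indep_weight [RHS](bigID (mem A)) /=; congr (_ * _).
  by apply: eq_bigr => i iA; rewrite iA /F AD.
rewrite [RHS](bigID (mem D)) /= [X in _ = _ * X]big1 ?mulr1.
  apply: eq_big => i; first by rewrite !inE.
  rewrite !inE => /andP[iA iD]; rewrite (negbTE iA) /G iD ifN //.
  by apply: contra iA; exact: CA.
move=> i /andP[/negbTE iA /negbTE iD]; rewrite iA /G iD ifN //.
by apply/negP => /CD; rewrite iD.
Qed.

End IndependentWeights.
Section Moments.
Variables (R : realDomainType) (I : finType) (D C : {set I}) (p : I -> R).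
Hypothesis CD : C \subset D.

Lemma indep_weight_mean :
  \sum_(A in powerset D) indep_weight D p A * #|C :&: A|%:R =
  \sum_(i in C) p i.
Proof.
transitivity (\sum_(A in powerset D) \sum_(i in C)
    if [set i] \subset A then indep_weight D p A else 0).
  apply: eq_bigr => A _; rewrite -big_mkcondr /= -sum1_card natr_sum mulr_sumr.
  by apply: eq_big => [i|i _]; rewrite ?mulr1 // inE sub1set.
rewrite exchange_big /=; apply: eq_bigr => i iC.
rewrite -big_mkcondr sum_indep_weight_sup ?big_set1 //.
by rewrite sub1set (subsetP CD).
Qed.

(** Distinct elements of [C] are uncorrelated, so the second moment exceeds the
square of the mean only through the diagonal terms. *)
Lemma indep_weight_sqr_le : (forall i, i \in C -> 0 <= p i) ->
  \sum_(A in powerset D) indep_weight D p A * #|C :&: A|%:R ^+ 2 <=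
  \sum_(i in C) p i + (\sum_(i in C) p i) ^+ 2.
Proof.
move=> p0.
have -> : \sum_(A in powerset D) indep_weight D p A * #|C :&: A|%:R ^+ 2 =
    \sum_(i in C) \sum_(j in C) \sum_(A in powerset D)
      if [set i; j] \subset A then indep_weight D p A else 0.
  under [RHS]eq_bigr do rewrite exchange_big.
  rewrite [RHS]exchange_big; apply: eq_bigr => A _.
  have -> : #|C :&: A|%:R = \sum_(i in C) (i \in A)%:R :> R.
    rewrite -sum1_card natr_sum (eq_bigl _ _ (fun i => in_setI i C A)).
    by rewrite big_mkcondr; apply: eq_bigr => i _; case: (i \in A).
  rewrite expr2 mulr_suml mulr_sumr; apply: eq_bigr => i _.
  rewrite !mulr_sumr; apply: eq_bigr => j _; rewrite subUset !sub1set.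
  by case: (i \in A); case: (j \in A); rewrite ?mul0r ?mulr0 ?mulr1.
rewrite expr2 mulr_suml -big_split /=; apply: ler_sum => i iC.
rewrite mulr_sumr (bigD1 i) //= [X in _ <= _ + X](bigD1 i) //=.
have sub2 j : j \in C -> [set i; j] \subset D.
  by move=> jC; rewrite subUset !sub1set !(subsetP CD).
rewrite -big_mkcondr sum_indep_weight_sup ?sub2 // setUid big_set1.
apply: lerD => //; rewrite -[leLHS]add0r; apply: lerD.
  by apply: mulr_ge0; exact: p0.
apply: ler_sum => j /andP[jC ji].
rewrite -big_mkcondr sum_indep_weight_sup ?sub2 //.
by rewrite big_setU1 ?big_set1 //= inE eq_sym.
Qed.

End Moments.

(** * One step of the process *)

Section OneStep.
Variables (R : realType) (T : finType) (e : rel T).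
Implicit Types (B : {set T}) (A : {set T * T}).

Definition step_mean B (F : {set T} -> R) : R :=
  \sum_(B' : {set T}) step_prob R e B B' * F B'.

Lemma step_meanE B F :
  step_mean B F = \sum_(A in powerset (attempts e B))
    indep_weight (attempts e B) (fun uv => force_prob R e B uv.1) A *
    F (next_blue B A).
Proof.
rewrite (partition_big (next_blue B) xpredT) //=; apply: eq_bigr => B' _.
by rewrite mulr_suml; apply: eq_bigr => A /andP[_ /eqP <-].
Qed.

Lemma card_closed_nbhd u : irreflexive e -> #|closed_nbhd e u| = (deg e u).+1.
Proof. by move=> ei; rewrite cardsU1 inE ei. Qed.

(** The white neighbour [v] is missing from the blue part of the closed
neighbourhood; this makes every force probability in use at most 1. *)
Lemma blue_nbhd_le_deg B u v : v \notin B -> e u v ->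
  (#|closed_nbhd e u :&: B| <= deg e u)%N.
Proof.
move=> vB uv; apply: (@leq_trans #|closed_nbhd e u :\ v|).
  apply: subset_leq_card; apply/subsetP => w; rewrite !inE => /andP[-> wB].
  by rewrite andbT; apply: contraNneq vB => <-.
have vu : v \in closed_nbhd e u by rewrite !inE uv orbT.
rewrite -ltnS -add1n.
have -> : (1 + #|closed_nbhd e u :\ v| = #|closed_nbhd e u|)%N.
  by rewrite (cardsD1 v (closed_nbhd e u)) vu.
by rewrite cardsU1 -add1n leq_add2r leq_b1.
Qed.

Lemma force_prob_ge0 B u : 0 <= force_prob R e B u.
Proof. by rewrite divr_ge0. Qed.

Lemma force_prob_le1 B u v : v \notin B -> e u v -> force_prob R e B u <= 1.
Proof.
move=> vB uv; have := blue_nbhd_le_deg vB uv; rewrite /force_prob.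
have [-> _|d0 bd] := posnP (deg e u); first by rewrite invr0 mulr0.
by rewrite ler_pdivrMr ?ltr0n // mul1r ler_nat.
Qed.

Lemma indep_weight_attempts_ge0 B A : A \subset attempts e B ->
  0 <= indep_weight (attempts e B) (fun uv => force_prob R e B uv.1) A.
Proof.
move=> AB; rewrite mulr_ge0 //; apply: prodr_ge0 => -[u v].
  by move=> _; exact: force_prob_ge0.
rewrite !inE /= => /andP[_ /and3P[_ vB uv]].
by rewrite subr_ge0 (force_prob_le1 vB uv).
Qed.

Lemma step_mean_cst B (c : R) : step_mean B (fun=> c) = c.
Proof.
rewrite step_meanE -mulr_suml -[RHS]mul1r; congr (_ * _).
have := sum_indep_weight_sup (fun uv => force_prob R e B uv.1) (sub0set (attempts e B)).
by rewrite big_set0 => <-; apply: eq_bigl => A; rewrite sub0set andbT.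
Qed.

Lemma step_meanZ B c F : step_mean B (fun B' => c * F B') = c * step_mean B F.
Proof. by rewrite /step_mean mulr_sumr; apply: eq_bigr => B' _; rewrite mulrCA. Qed.

Lemma step_meanD B F G :
  step_mean B (fun B' => F B' + G B') = step_mean B F + step_mean B G.
Proof. by rewrite /step_mean -big_split; apply: eq_bigr => B' _; rewrite mulrDr. Qed.

Lemma step_mean_sum (I : Type) (r : seq I) (P : pred I) B (F : I -> {set T} -> R) :
  step_mean B (fun B' => \sum_(i <- r | P i) F i B') =
  \sum_(i <- r | P i) step_mean B (F i).
Proof.
by rewrite exchange_big; apply: eq_bigr => B' _; rewrite mulr_sumr.
Qed.

Lemma ler_step_mean B F G : (forall B', B \subset B' -> F B' <= G B') ->
  step_mean B F <= step_mean B G.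
Proof.
move=> FG; rewrite !step_meanE; apply: ler_sum => A.
rewrite powersetE => AB; apply: ler_wpM2l; first exact: indep_weight_attempts_ge0.
by apply: FG; exact: subsetUl.
Qed.

End OneStep.

(** * Expected propagation time and drift *)

Section Drift.
Variables (R : realType) (T : finType) (e : rel T).
Implicit Types (B S : {set T}).

(* A trajectory up to time [t.+1] is its initial set followed by a trajectory up
   to time [t]; this bijection turns the sums over trajectories into a
   first-step recursion. *)
Let cons_traj t (Bx : {set T} * {ffun 'I_t.+1 -> {set T}}) :
    {ffun 'I_t.+2 -> {set T}} :=
  [ffun i => oapp Bx.2 Bx.1 (unlift ord0 i)].

Let cons_traj0 t Bx : @cons_traj t Bx ord0 = Bx.1.
Proof. by rewrite ffunE unlift_none. Qed.

Let cons_trajS t Bx i : @cons_traj t Bx (lift ord0 i) = Bx.2 i.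
Proof. by rewrite ffunE liftK. Qed.

Let cons_traj_bij t : bijective (@cons_traj t).
Proof.
exists (fun x : {ffun 'I_t.+2 -> {set T}} => (x ord0, [ffun i => x (lift ord0 i)])) => [[B x]|x].
  rewrite cons_traj0 /=; congr pair; apply/ffunP => i.
  by rewrite ffunE cons_trajS.
apply/ffunP => i; case: (unliftP ord0 i) => [j|] ->.
  by rewrite cons_trajS ffunE.
by rewrite cons_traj0.
Qed.

Lemma pt_pmf0 S : pt_pmf R e S 0 = (S == [set: T])%:R.
Proof.
have c_bij : bijective (fun B : {set T} => [ffun=> B] : {ffun 'I_1 -> {set T}}).
  exists (fun x : {ffun 'I_1 -> {set T}} => x ord0) => [B|x]; first by rewrite ffunE.
  by apply/ffunP => i; rewrite ffunE ord1.
rewrite /pt_pmf (reindex _ (onW_bij _ c_bij)) /=.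
rewrite (eq_bigl (pred1 [set: T])) => [|B]; last first.
  rewrite /first_full !ffunE /=; case: eqP => //= _.
  exact/forallP.
by rewrite big_pred1_eq /traj_prob big_ord0 mulr1 ffunE eq_sym.
Qed.

(** First-step analysis: from a set that is not full, the remaining time after
one step is distributed as the propagation time from the next set. *)
Lemma pt_pmfS S t : pt_pmf R e S t.+1 =
  (S != [set: T])%:R * step_mean e S (fun B => pt_pmf R e B t).
Proof.
rewrite /pt_pmf (reindex _ (onW_bij _ (cons_traj_bij t))) /=.
have fullE Bx : first_full (cons_traj Bx) =
    (Bx.1 != [set: T]) && @first_full T t Bx.2.
  rewrite /first_full (_ : ord_max = lift ord0 ord_max); last exact: val_inj.
  rewrite cons_trajS andbCA; congr (_ && _).
  apply/forallP/andP => [x1|[x0 /forallP xS] i].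
    split; first by have := x1 ord0; rewrite cons_traj0.
    apply/forallP => i; have := x1 (lift ord0 i).
    by rewrite cons_trajS lift0.
  case: (unliftP ord0 i) => [j|] ->; last by rewrite cons_traj0 x0 implybT.
  by rewrite cons_trajS lift0 ltnS.
have trajE B x : traj_prob R e S (cons_traj (B, x)) =
    (B == S)%:R * \sum_B' step_prob R e S B' * @traj_prob R T e B' t x.
  rewrite /traj_prob cons_traj0 /=; case: eqP => [->|]; last by rewrite !mul0r.
  rewrite !mul1r (bigD1 (x ord0)) //= eqxx mul1r [X in _ = _ + X]big1 => [|B']; last first.
    by rewrite eq_sym => /negbTE ->; rewrite mul0r mulr0.
  rewrite addr0 big_ord_recl.
  rewrite (_ : widen_ord _ ord0 = ord0); last exact: val_inj.
  rewrite cons_traj0 cons_trajS /=; congr (_ * _); apply: eq_bigr => i _.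
  rewrite cons_trajS (_ : widen_ord _ (lift ord0 i) = lift ord0 (widen_ord (leqnSn t) i)).
    by rewrite cons_trajS.
  exact: val_inj.
rewrite (eq_bigl _ _ fullE).
rewrite -(pair_big (fun B => B != [set: T]) (@first_full T t)
  (fun B x => traj_prob R e S (cons_traj (B, x)))) /=.
have -> : \sum_(B : {set T} | B != [set: T]) \sum_(x | @first_full T t x)
    traj_prob R e S (cons_traj (B, x)) =
    \sum_(B : {set T} | B != [set: T]) (B == S)%:R *
      step_mean e S (fun B' => pt_pmf R e B' t).
  apply: eq_bigr => B _; under eq_bigr do rewrite trajE.
  rewrite -mulr_sumr; congr (_ * _); rewrite exchange_big.
  by apply: eq_bigr => B' _; rewrite mulr_sumr.
rewrite -mulr_suml; congr (_ * _).
case: (boolP (S == [set: T])) => [/eqP ->|SN] /=.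
  by rewrite big1 // => B /negbTE ->.
by rewrite (bigD1 S) //= eqxx big1 ?addr0 // => B /andP[_ /negbTE ->].
Qed.

Definition pt_tail S (t : nat) : R := 1 - \sum_(s < t.+1) pt_pmf R e S s.

Lemma pt_tail0 S : pt_tail S 0 = (S != [set: T])%:R.
Proof.
rewrite /pt_tail big_ord1 pt_pmf0; case: eqP => _ /=; first by rewrite subrr.
by rewrite subr0.
Qed.

Lemma pt_tailS S t :
  pt_tail S t.+1 = (S != [set: T])%:R * step_mean e S (pt_tail^~ t).
Proof.
rewrite /pt_tail big_ord_recl.
under eq_bigr do rewrite lift0 pt_pmfS.
rewrite pt_pmf0 -mulr_sumr -step_mean_sum.
case: eqP => _ /=; first by rewrite !mul0r addr0 subrr.
rewrite add0r !mul1r.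
under [in RHS]eq_fun do rewrite -mulN1r.
by rewrite step_meanD step_mean_cst step_meanZ mulN1r.
Qed.

Lemma pt_pmf_ge0 S t : 0 <= pt_pmf R e S t.
Proof.
elim: t S => [|t IH] S; first by rewrite pt_pmf0.
rewrite pt_pmfS mulr_ge0 // -(step_mean_cst e S (0 : R)).
by apply: ler_step_mean => B _; exact: IH.
Qed.

Lemma pt_tail_ge0 S t : 0 <= pt_tail S t.
Proof.
elim: t S => [|t IH] S; first by rewrite pt_tail0.
rewrite pt_tailS mulr_ge0 // -(step_mean_cst e S (0 : R)).
by apply: ler_step_mean => B _; exact: IH.
Qed.

Lemma pt_tail_decr S t : pt_tail S t.+1 = pt_tail S t - pt_pmf R e S t.+1.
Proof. by rewrite /pt_tail [in LHS]big_ord_recr /= opprD addrA. Qed.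

Lemma pt_tail_nonincr S : {homo pt_tail S : s t / (s <= t)%N >-> t <= s}.
Proof.
apply: homo_leq => [x|y x z xy yz|t] //; first exact: le_trans yz xy.
by rewrite pt_tail_decr gerBl pt_pmf_ge0.
Qed.

(** Both sides are the expectation of the propagation time truncated at [N]. *)
Lemma sum_pt_pmf_tail S N :
  \sum_(t < N.+1) t%:R * pt_pmf R e S t + N%:R * pt_tail S N =
  \sum_(t < N) pt_tail S t.
Proof.
elim: N => [|N IH]; first by rewrite big_ord1 big_ord0 !mul0r addr0.
rewrite big_ord_recr [RHS]big_ord_recr /= -IH pt_tail_decr.
ring.
Qed.

(** The left-hand side is the expected propagation time truncated at [N]; each
step taken before the graph is blue is paid by the decrease of [V]. *)
Lemma sum_pt_tail_le S (V : {set T} -> R) :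
  (forall B, 0 <= V B) ->
  (forall B, S \subset B -> B != [set: T] -> step_mean e B V <= V B - 1) ->
  forall N, \sum_(t < N) pt_tail S t <= V S.
Proof.
move=> V0 drift N.
have : forall B, S \subset B -> \sum_(t < N) pt_tail B t <= V B; last exact.
elim: N => [|N IH] B SB; first by rewrite big_ord0.
rewrite big_ord_recl pt_tail0.
under eq_bigr do rewrite lift0 pt_tailS.
rewrite -mulr_sumr -step_mean_sum.
have [_|BN] := eqVneq B; first by rewrite mul0r addr0.
rewrite mul1r -lerBrDl; apply: le_trans (drift B SB BN).
by apply: ler_step_mean => B' BB'; apply/IH/(subset_trans SB).
Qed.

(** Foster's criterion.  Since the truncated expectations stay below [V S], the
tail at [N] is at most [V S / N.+1]; so propagation is almost surely complete
and the infinite term in the definition of the expectation vanishes. *)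
Lemma ept_le_drift S (V : {set T} -> R) :
  (forall B, 0 <= V B) ->
  (forall B, S \subset B -> B != [set: T] -> step_mean e B V <= V B - 1) ->
  (ept R e S <= (V S)%:E)%E.
Proof.
move=> V0 drift; have tailV := sum_pt_tail_le V0 drift.
have tail_le N : pt_tail S N <= V S * N.+1%:R^-1.
  rewrite ler_pdivlMr // mulrC; apply: le_trans (tailV N.+1).
  have -> : N.+1%:R * pt_tail S N = \sum_(t < N.+1) pt_tail S N.
    by rewrite sumr_const card_ord mulr_natl.
  apply: ler_sum => t _; apply: pt_tail_nonincr.
  by rewrite -ltnS.
have tail_cvg0 : (pt_tail S N @[N --> \oo] --> (0 : R))%classic.
  apply: (@squeeze_cvgr _ _ _ _ (cst 0) (fun N => V S * N.+1%:R^-1)).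
  - by apply: nearW => N; rewrite pt_tail_ge0 tail_le.
  - exact: cvg_cst.
  - by rewrite -(mulr0 (V S)); apply: cvgM; [exact: cvg_cst|exact: cvg_harmonic].
have sumE (u : nat -> R) : (fun N => (\sum_(0 <= t < N) (u t)%:E)%E) =
    (fun N => (\sum_(t < N) u t)%:E).
  by apply/funext => N; rewrite sumEFin big_mkord.
have pmf1 : (\sum_(0 <= t <oo) (pt_pmf R e S t)%:E = 1)%E.
  apply/cvg_lim => //; rewrite sumE.
  apply/fine_cvgP; split; first exact: nearW.
  rewrite -cvg_shiftS /=.
  rewrite (_ : (fun N => _) = (fun N => 1 - pt_tail S N)); last first.
    by apply/funext => N; rewrite /pt_tail opprB addrC subrK.
  have : ((1 - pt_tail S N) @[N --> \oo] --> (1 - 0 : R))%classic.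
    by apply: cvgB => //; exact: cvg_cst.
  by rewrite subr0.
rewrite /ept pmf1 subee // mule0 adde0.
apply: lime_le.
  by apply: is_cvg_nneseries => t _ _; rewrite mule_ge0 // lee_fin // pt_pmf_ge0.
apply: nearW => N; under eq_bigr do rewrite -EFinM.
rewrite sumEFin lee_fin big_mkord.
apply: le_trans (tailV N); rewrite -sum_pt_pmf_tail big_ord_recr /=.
rewrite -addrA lerDl addr_ge0 // mulr_ge0 ?pt_pmf_ge0 ?pt_tail_ge0 //.
Qed.

End Drift.

(** * Forcing along a path *)

Section Potential.
Variables (R : realType) (T : finType) (e : rel T).
Hypothesis irr_e : irreflexive e.
Implicit Types (B : {set T}) (u v w : T) (q : seq T).

(** The factor 2 makes the potential below at least 2 while a neighbour is
white, so that forcing that neighbour, which resets the potential to 1, at least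
halves it. *)
Definition vertex_cost u : nat := 2 * (deg e u).+1.

Definition edge_potential B u : R := (vertex_cost u)%:R / #|closed_nbhd e u :&: B|%:R.

(** A quadratic upper bound of [1 / (1 + x)] for [x = X / b]; it reduces the
expectation of the inverse to two moments of [X].  The coefficients are small
enough to leave a net gain when [E x >= 1 / 2] and [E x ^ 2 <= 2]. *)
Lemma inv_add_le (b X : R) : 0 < b -> 0 <= X ->
  (b + X)^-1 <= b^-1 * (1 - X / (5 * b) + X ^+ 2 / (80 * b ^+ 2)).
Proof.
move=> b0 X0; have bX : 0 < b + X by rewrite ltr_wpDr.
rewrite -[leLHS]mulr1 ler_pdivrMl //.
rewrite -subr_ge0.
have -> : (b + X) * (b^-1 * (1 - X / (5 * b) + X ^+ 2 / (80 * b ^+ 2))) - 1 =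
   X * ((X - 15 / 2 * b) ^+ 2 + 31 / 4 * b ^+ 2) / (80 * b ^+ 3).
  by field; rewrite gt_eqF.
have b0' := ltW b0; apply: divr_ge0; last by rewrite mulr_ge0 ?exprn_ge0.
by rewrite mulr_ge0 // addr_ge0 ?sqr_ge0 // mulr_ge0 ?exprn_ge0 //; lra.
Qed.

Section Star.
Variables (B : {set T}) (u v : T).
Hypotheses (uB : u \in B) (vB : v \notin B) (uv : e u v).

Let b := #|closed_nbhd e u :&: B|.
Let d := deg e u.
(* The attempts of [u] alone; those of the other blue vertices can only help. *)
Let fresh : {set T * T} := [set (u, w) | w in nbhd e u :\: B].

Let b_gt0 : (0 < b)%N.
Proof. by apply/card_gt0P; exists u; rewrite !inE eqxx uB. Qed.

Let b_le_d : (b <= d)%N.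
Proof. exact: blue_nbhd_le_deg vB uv. Qed.

Let fresh_attempts : fresh \subset attempts e B.
Proof.
apply/subsetP => _ /imsetP[w + ->]; rewrite !inE /= => /andP[-> ->].
by rewrite uB.
Qed.

Let card_fresh : (#|fresh| + b = d.+1)%N.
Proof.
rewrite card_imset => [|w w' [] //].
rewrite -card_closed_nbhd // -[RHS](cardsID B) addnC; congr (_ + _)%N.
apply: eq_card => w; rewrite !inE; case: eqP => // ->.
by rewrite uB.
Qed.

Let card_next_ge (A : {set T * T}) :
  (b + #|fresh :&: A| <= #|closed_nbhd e u :&: next_blue B A|)%N.
Proof.
pose hit := [set w in nbhd e u :\: B | (u, w) \in A].
have -> : #|fresh :&: A| = #|hit|.
  rewrite -(card_imset hit (f := pair u)) => [|w w' [] //].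
  apply: eq_card => x; rewrite inE; apply/andP/imsetP.
    by move=> [/imsetP[w wN ->] wA]; exists w; rewrite // inE wN.
  move=> [w + ->]; rewrite inE => /andP[wN wA]; split=> //.
  exact: imset_f.
have disj : closed_nbhd e u :&: B :&: hit = set0.
  by apply/setP => w; rewrite !inE; case: (w \in B); rewrite ?andbF.
rewrite -cardsUI disj cards0 addn0.
apply: subset_leq_card; apply/subsetP => w; rewrite !inE.
case/orP => [/andP[-> ->] //|/andP[/andP[wB uw] wA]].
by rewrite uw orbT /=; apply/orP; right; apply/imsetP; exists (u, w).
Qed.

Let sum_fresh : \sum_(i in fresh) force_prob R e B i.1 = #|fresh|%:R * (b%:R / d%:R).
Proof.
rewrite mulr_natl -sumr_const; apply: eq_bigr => _ /imsetP[w _ ->].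
by [].
Qed.

Lemma edge_potential_ge1 B' : u \in B' -> 1 <= edge_potential B' u.
Proof.
move=> uB'; rewrite /edge_potential ler_pdivlMr ?mul1r ?ler_nat; last first.
  by rewrite ltr0n; apply/card_gt0P; exists u; rewrite !inE eqxx uB'.
apply: (@leq_trans (deg e u).+1); last by rewrite leq_pmull.
by rewrite -card_closed_nbhd // subset_leq_card // subsetIl.
Qed.

(** When at most half of the neighbours are blue, the number [X] of neighbours
that [u] forces has mean between [b / 2] and [b] and second moment at most
[2 b ^ 2], which gives the factor [1 - 1/10 + 1/40].  Otherwise [v] itself is
forced with probability at least [1/2], which gives the factor [3/4]. *)
Lemma edge_potential_drift :
  step_mean e B (fun B' => if v \in B' then 1 else edge_potential B' u) <=
  37 / 40 * edge_potential B u.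
Proof.
have M0 : 0 <= (vertex_cost u)%:R :> R by [].
have b0 : 0 < b%:R :> R by rewrite ltr0n.
have d0 : 0 < d%:R :> R by rewrite ltr0n (leq_trans b_gt0).
have b1 : 1 <= b%:R :> R by rewrite ler1n.
have bd : b%:R <= d%:R :> R by rewrite ler_nat.
rewrite /edge_potential -/b; set M := (vertex_cost u)%:R.
have ME : M = 2 * (d%:R + 1) by rewrite /M /vertex_cost natrM -[(deg e u).+1%:R]natr1.
have [bd2|bd2] := leP (2 * b%:R : R) d%:R.
-   pose X A : R := #|fresh :&: A|%:R.
  pose wt A := indep_weight (attempts e B) (fun x => force_prob R e B x.1) A.
  apply: (@le_trans _ _ (\sum_(A in powerset (attempts e B)) wt A *
      (M * (b%:R^-1 * (1 - X A / (5 * b%:R) + X A ^+ 2 / (80 * b%:R ^+ 2)))))).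
    rewrite step_meanE; apply: ler_sum => A; rewrite powersetE => AB.
    apply: ler_wpM2l; first exact: indep_weight_attempts_ge0.
    have uB' : u \in next_blue B A by rewrite inE uB.
    apply: (@le_trans _ _ (edge_potential (next_blue B A) u)).
      by case: ifP => // _; exact: edge_potential_ge1.
    apply: ler_wpM2l => //; apply: le_trans (inv_add_le b0 _); last by [].
    rewrite lef_pV2 ?posrE ?ltr_wpDr // -?natrD ?ler_nat ?card_next_ge //.
    by rewrite ltr0n (leq_trans _ (card_next_ge A)) // addn_gt0 b_gt0.
  have wt1 : \sum_(A in powerset (attempts e B)) wt A = 1.
    by have := step_mean_cst e B (1 : R); rewrite step_meanE; under eq_bigr do rewrite mulr1.
  have := indep_weight_mean (fun x => force_prob R e B x.1) fresh_attempts.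
  have := @indep_weight_sqr_le R _ _ _ (fun x => force_prob R e B x.1)
    fresh_attempts (fun x _ => force_prob_ge0 R e B x.1).
  rewrite sum_fresh -/wt => EX2 EX.
  set mu := #|fresh|%:R * _ in EX EX2.
  have -> : \sum_(A in powerset (attempts e B)) wt A *
      (M * (b%:R^-1 * (1 - X A / (5 * b%:R) + X A ^+ 2 / (80 * b%:R ^+ 2)))) =
      M / b%:R * (1 - mu / (5 * b%:R) +
        (\sum_(A in powerset (attempts e B)) wt A * X A ^+ 2) / (80 * b%:R ^+ 2)).
    rewrite -EX -[X in _ = _ * (X - _ + _)]wt1 !mulr_suml -sumrN -!big_split mulr_sumr /=.
    by apply: eq_bigr => A _; rewrite /X -/(wt A); ring.
  rewrite [leLHS]mulrC; apply: ler_wpM2r; first by rewrite divr_ge0.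
  have fE : #|fresh|%:R = d%:R + 1 - b%:R :> R.
    by rewrite natr1 -card_fresh natrD addrK.
  have muE : mu = (d%:R + 1 - b%:R) / d%:R * b%:R by rewrite /mu fE mulrAC mulrA.
  have mu_le : mu <= b%:R.
    by rewrite muE -[leRHS]mul1r ler_wpM2r ?ler_pdivrMr //; lra.
  have mu_ge : b%:R / 2 <= mu.
    by rewrite muE mulrC ler_wpM2r ?ler_pdivlMr //; lra.
  have h1 : 1 / 10 <= mu / (5 * b%:R) by rewrite ler_pdivlMr ?mulr_gt0 //; lra.
  have h2 : (\sum_(A in powerset (attempts e B)) wt A * X A ^+ 2) / (80 * b%:R ^+ 2) <= 1 / 40.
    rewrite ler_pdivrMr ?mulr_gt0 ?exprn_gt0 //; apply: (le_trans EX2); nra.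
  lra.
-   have phi2 : 2 <= M / b%:R by rewrite ler_pdivlMr // ME; lra.
  have p2 : 1 / 2 <= b%:R / d%:R :> R by rewrite ler_pdivlMr //; lra.
  have uvD : [set (u, v)] \subset attempts e B by rewrite sub1set !inE /= uB vB.
  pose wt A := indep_weight (attempts e B) (fun x => force_prob R e B x.1) A.
  apply: (@le_trans _ _ (\sum_(A in powerset (attempts e B)) wt A *
      (M / b%:R - (M / b%:R - 1) * #|[set (u, v)] :&: A|%:R))).
    rewrite step_meanE; apply: ler_sum => A; rewrite powersetE => AB.
    apply: ler_wpM2l; first exact: indep_weight_attempts_ge0.
    have [uvA|uvA] := boolP ((u, v) \in A).
      have -> : v \in next_blue B A.
        by rewrite inE; apply/orP; right; apply/imsetP; exists (u, v).
      rewrite (setIidPl _) ?sub1set // cards1; lra.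
    have -> : #|[set (u, v)] :&: A| = 0%N.
      by apply/eqP; rewrite cards_eq0 setI_eq0 disjoints1.
    rewrite mulr0 subr0; case: ifP => _; first lra.
    apply: ler_wpM2l => //; rewrite lef_pV2 ?posrE ?ler_nat ?ltr0n //.
      by apply: leq_trans (card_next_ge A); exact: leq_addr.
    by rewrite (leq_trans _ (card_next_ge A)) // addn_gt0 b_gt0.
  have wt1 : \sum_(A in powerset (attempts e B)) wt A = 1.
    by have := step_mean_cst e B (1 : R); rewrite step_meanE; under eq_bigr do rewrite mulr1.
  have := indep_weight_mean (fun x => force_prob R e B x.1) uvD.
  rewrite big_set1 /= -/wt => EX.
  have -> : \sum_(A in powerset (attempts e B)) wt A *
      (M / b%:R - (M / b%:R - 1) * #|[set (u, v)] :&: A|%:R) =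
      M / b%:R - (M / b%:R - 1) * (b%:R / d%:R).
    rewrite -[b%:R / d%:R]EX -[X in _ = X - _]mulr1 -wt1 !mulr_sumr -sumrB.
    by apply: eq_bigr => A _; rewrite -/(wt A); ring.
  nra.
Qed.

End Star.

Hypothesis sym_e : symmetric e.

(** The path [q] leads from the target [v] back to a blue vertex.  The full cost
charged for a white vertex is an upper bound of the edge potential that the
vertex gets when it turns blue, so advancing along the path never raises the
potential. *)
Fixpoint path_potential B v q : R :=
  if v \in B then 1 else
  if q is w :: q' then
    if w \in B then edge_potential B w
    else (vertex_cost w)%:R * path_potential B w q'
  else 1.

Lemma path_potential_ge1 B v q : 1 <= path_potential B v q.
Proof.
elim: q v => [|w q IH] v /=; first by case: ifP.
case: ifP => // _; case: ifPn => [|_]; first exact: edge_potential_ge1.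
by rewrite mulr_ege1 ?ler1n.
Qed.

Lemma path_potential_cons_le B v w q :
  path_potential B v (w :: q) <= (vertex_cost w)%:R * path_potential B w q.
Proof.
have c1 : 1 <= (vertex_cost w)%:R :> R by rewrite ler1n.
rewrite [leLHS]/=; case: ifP => _; first by rewrite mulr_ege1 ?path_potential_ge1.
case: ifPn => // wB; rewrite ler_pM ?invr_ge0 //.
apply: le_trans (path_potential_ge1 _ _ _); rewrite invf_le1 ?ler1n ?ltr0n.
all: by apply/card_gt0P; exists w; rewrite !inE eqxx wB.
Qed.

Lemma path_potential_le_prod B v q :
  path_potential B v q <= (\prod_(w <- q) vertex_cost w)%:R.
Proof.
elim: q v => [|w q IH] v; first by rewrite big_nil /=; case: ifP.
apply: le_trans (path_potential_cons_le _ _ _ _) _.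
by rewrite big_cons natrM ler_wpM2l.
Qed.

(** While the neighbour [w] of [v] is white, the potential of [v] is dominated
by a constant times that of [w], which drifts by induction; once [w] is blue,
the edge from [w] to [v] drifts. *)
Lemma path_potential_drift B v q : path e v q -> last v q \in B -> v \notin B ->
  step_mean e B (fun B' => path_potential B' v q) <= 37 / 40 * path_potential B v q.
Proof.
elim: q v => [|w q IH] v /=; first by move=> _ vB; rewrite vB.
move=> /andP[vw pq] qB vB; rewrite (negbTE vB).
have [wB|wB] := boolP (w \in B).
  rewrite sym_e in vw; apply: le_trans (edge_potential_drift wB vB vw).
  apply: ler_step_mean => B' /subsetP BB'.
  by case: ifP => // _; rewrite BB'.
rewrite mulrCA; apply: (@le_trans _ _ (step_mean e B
    (fun B' => (vertex_cost w)%:R * path_potential B' w q))).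
  by apply: ler_step_mean => B' _; exact: path_potential_cons_le.
by rewrite step_meanZ ler_wpM2l // IH.
Qed.

(** The tangent line of the concave function [ln (1 + _)] at [x]; it takes the
place of Jensen's inequality. *)
Lemma ln1D_le (x y : R) : 0 <= x -> 0 <= y ->
  ln (1 + y) <= ln (1 + x) + (y - x) / (1 + x).
Proof.
move=> x0 y0; have x1 : 0 < 1 + x by rewrite ltr_wpDr.
rewrite -lerBlDl -ln_div ?posrE ?ltr_wpDr //.
rewrite (_ : (1 + y) / (1 + x) = 1 + (y - x) / (1 + x)); last first.
  by field; rewrite gt_eqF.
apply: le_ln1Dx; rewrite ltr_pdivlMr //; lra.
Qed.

(** With [Phi] the sum of the path potentials of the white vertices, the tangent
bound gives [ln (1 + Phi)] the drift [- (3 / 40) Phi / (1 + Phi)], which is at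
most [- 3 / 80] as long as [Phi >= 1]; hence the factor [80 / 3]. *)
Lemma ept_le_paths (S : {set T}) (q : T -> seq T) (c : nat) :
  (forall v, path e v (q v)) -> (forall v, last v (q v) \in S) ->
  (forall v, \prod_(w <- q v) vertex_cost w <= c)%N ->
  (ept R e S <= (80 / 3 * ln (1 + #|T|%:R * c%:R))%:E)%E.
Proof.
move=> pq qS qc.
pose Phi B := \sum_(v in ~: B) path_potential B v (q v).
have Phi0 B : 0 <= Phi B.
  by apply: sumr_ge0 => v _; apply: le_trans (path_potential_ge1 _ _ _).
pose V B : R := 80 / 3 * ln (1 + Phi B).
have V0 B : 0 <= V B by rewrite mulr_ge0 // ln_ge0 // lerDl.
apply: (@le_trans _ _ (V S)%:E).
  apply: ept_le_drift => // B /subsetP SB BN.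
  have Phi1 : 1 <= Phi B.
    have [v vB] : exists v, v \notin B.
      apply/existsP; rewrite -negb_forall; apply: contra BN => /forallP BT.
      by apply/eqP/setP => v; rewrite BT inE.
    rewrite /Phi (bigD1 v) ?inE //= -[leLHS]addr0 lerD ?path_potential_ge1 //.
    by apply: sumr_ge0 => w _; apply: le_trans (path_potential_ge1 _ _ _).
  have drift : step_mean e B Phi <= 37 / 40 * Phi B.
    apply: (@le_trans _ _ (step_mean e B
        (fun B' => \sum_(v in ~: B) path_potential B' v (q v)))).
      apply: ler_step_mean => B' /subsetP BB'.
      rewrite /Phi [leRHS](bigID (mem (~: B'))) /= -[leLHS]addr0 lerD //.
        rewrite le_eqVlt; apply/orP; left; apply/eqP; apply: eq_bigl => v.
        rewrite !inE; have := BB' v.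
        by case: (v \in B) => // ->.
      by apply: sumr_ge0 => w _; apply: le_trans (path_potential_ge1 _ _ _).
    rewrite step_mean_sum mulr_sumr; apply: ler_sum => v; rewrite inE => vB.
    by apply: path_potential_drift => //; exact/SB.
  have P1 : 0 < 1 + Phi B by rewrite ltr_wpDr.
  apply: (@le_trans _ _ (step_mean e B (fun B' => 80 / 3 *
      ((ln (1 + Phi B) - Phi B / (1 + Phi B)) + (1 + Phi B)^-1 * Phi B')))).
    apply: ler_step_mean => B' _; rewrite /V ler_pM2l //.
    apply: le_trans (ln1D_le (Phi0 B) (Phi0 B')) _.
    by rewrite le_eqVlt; apply/orP; left; apply/eqP; ring.
  rewrite step_meanZ step_meanD step_mean_cst step_meanZ.
  have : (1 + Phi B)^-1 * step_mean e B Phi <=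
      37 / 40 * (Phi B / (1 + Phi B)).
    by rewrite mulrC mulrA ler_pM2r ?invr_gt0.
  have : 1 / 2 <= Phi B / (1 + Phi B) by rewrite ler_pdivlMr //; lra.
  rewrite /V; lra.
rewrite lee_fin /V ler_pM2l // ler_ln ?posrE ?ltr_wpDr ?mulr_ge0 // lerD2l.
apply: (@le_trans _ _ (\sum_(v : T) c%:R)).
  rewrite /Phi [leRHS](bigID (mem (~: S))) /= -[leLHS]addr0 lerD ?sumr_ge0 //.
  apply: ler_sum => v _; apply: le_trans (path_potential_le_prod _ _ _) _.
  by rewrite ler_nat.
by rewrite sumr_const mulr_natl.
Qed.

End Potential.

(** * Cheap paths to a small set *)

(** A maximal subfamily of pairwise disjoint sets meets every set of the
family. *)
Lemma packing (I T : finType) (F : I -> {set T}) (m : nat) :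
  (0 < m)%N -> (forall i, (m <= #|F i|)%N) ->
  exists2 S : {set I}, (#|S| * m <= #|T|)%N &
    forall i, exists2 s, s \in S & ~~ [disjoint F i & F s].
Proof.
move=> m0 mF.
pose P (S : {set I}) := [forall s in S, forall t in S, (s != t) ==> [disjoint F s & F t]].
have [|S /maxsetP[/forall_inP PS maxS]] := @ex_maxset _ P.
  by exists set0; apply/forall_inP => s; rewrite inE.
exists S.
  apply: (@leq_trans (\sum_(s in S) #|F s|)).
    by rewrite -sum_nat_const; apply: leq_sum => s _; exact: mF.
  under eq_bigr do rewrite -sum1_card big_mkcond.
  rewrite exchange_big /= -[leqRHS]sum1_card; apply: leq_sum => x _.
  rewrite -big_mkcondr sum1dep_card; apply/card_le1_eqP => s t.
  rewrite !inE => /andP[sS xs] /andP[tS xt]; apply/eqP; apply: contraTT xt; rewrite eq_sym => st.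
  have /forall_inP/(_ t tS)/implyP/(_ st) := PS s sS.
  by move=> /disjointFr -> .
move=> i; apply/exists_inP; rewrite -negb_forall_in; apply/negP => /forall_inP iS.
have iNS : i \notin S.
  apply/negP => /iS /pred0P/(_ _)/= F0.
  have := leq_trans m0 (mF i); rewrite lt0n => /negP[]; apply/eqP/eq_card0 => x.
  by have := F0 x; rewrite andbb.
suff /(maxS _) : P (i |: S).
  by move=> /(_ (subsetUr _ _)) E; rewrite -E setU11 in iNS.
apply/forall_inP => s sS; apply/forall_inP => t tS; apply/implyP => st.
move: sS tS; rewrite !in_setU1 => /predU1P[si|sS] /predU1P[ti|tS].
- by rewrite si ti eqxx in st.
- by rewrite si iS.
- by rewrite ti disjoint_sym iS.
- by have /forall_inP/(_ t tS)/implyP/(_ st) := PS s sS.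
Qed.

Section Links.
Variables (T : finType) (e : rel T).
Hypotheses (sym_e : symmetric e) (irr_e : irreflexive e).
Local Open Scope nat_scope.
Implicit Types (v x y z : T) (q : seq T) (c : nat).

Local Notation cost := (vertex_cost e).

(** All vertices of the path are charged, both ends included, which keeps the
relation symmetric. *)
Definition linked c x y : Prop :=
  exists q, [/\ path e x q, last x q = y & \prod_(w <- x :: q) cost w <= c].

Lemma linked_sym c x y : linked c x y -> linked c y x.
Proof.
move=> [q [xq <- qc]]; exists (rev (belast x q)); split.
- by rewrite rev_path (eq_path (e' := e)) // => z t; rewrite sym_e.
- by case: q {xq qc} => //= z q; rewrite rev_cons last_rcons.
- rewrite (perm_big (x :: q)) //= -rev_rcons -lastI.
  by rewrite perm_rev.
Qed.

Lemma linked_trans c c' x y z :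
  linked c x y -> linked c' y z -> linked (c * c') x z.
Proof.
move=> [q [xq qy qc]] [q' [yq' qz qc']]; exists (q ++ q'); split.
- by rewrite cat_path xq qy.
- by rewrite last_cat qy.
- rewrite -cat_cons big_cat /=; apply: leq_mul => //; apply: leq_trans qc'.
  by rewrite big_cons leq_pmull.
Qed.

Lemma linked_step c x y z : e x y -> linked c y z -> linked (cost x * c) x z.
Proof.
move=> xy [q [yq qz qc]]; exists (y :: q); split => //=; first by rewrite xy.
by rewrite big_cons leq_mul2l qc orbT.
Qed.

Lemma linked_refl x : linked (cost x) x x.
Proof. by exists [::]; split => //; rewrite big_seq1. Qed.

Lemma linked_le c c' x y : c <= c' -> linked c x y -> linked c' x y.
Proof. by move=> cc' [q [? ? qc]]; exists q; split => //; exact: leq_trans cc'. Qed.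

Fixpoint ball v k : {set T} :=
  if k is k'.+1 then \bigcup_(y in ball v k') closed_nbhd e y else [set v].

Lemma closed_nbhd_sub_ball v k x : x \in ball v k -> closed_nbhd e x \subset ball v k.+1.
Proof. by move=> xk; apply: (bigcup_sup x). Qed.

Lemma ball_subS v k : ball v k \subset ball v k.+1.
Proof.
apply/subsetP => x xk; apply: (subsetP (closed_nbhd_sub_ball xk)).
exact: setU11.
Qed.

Lemma ball_succ v k x : x \in ball v k.+1 ->
  exists2 y, y \in ball v k & (x == y) || e x y.
Proof.
by move=> /bigcupP[y yk]; rewrite !inE => xy; exists y => //; rewrite sym_e.
Qed.

Lemma connected_ball : connected_graph e -> forall v, ball v #|T| = [set: T].
Proof.
move=> conn v; apply/setP => y; rewrite inE.
have path_ball p x k : x \in ball v k -> path e x p -> last x p \in ball v (k + size p).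
  elim: p x k => [|z p IH] x k xk /=; first by rewrite addn0.
  move=> /andP[xz zp]; rewrite -addSnnS; apply: IH => //.
  by apply: (subsetP (closed_nbhd_sub_ball xk)); rewrite !inE xz orbT.
have sub j k : ball v k \subset ball v (j + k).
  elim: j => [|j IH] //; apply: subset_trans IH _; exact: ball_subS.
have /connectP[p vp ->] := conn v y.
case/shortenP: vp => p' vp' up' _.
have sz : size p' <= #|T|.
  by apply: (@leq_trans (size (v :: p'))); rewrite // -(card_uniqP up') max_card.
have := path_ball p' v 0 (set11 v) vp'; rewrite add0n => /(subsetP (sub (#|T| - size p') _)).
by rewrite subnK.
Qed.

Lemma vertex_cost_le_exp x : cost x <= 2 ^ (deg e x).+1.
Proof. by rewrite /vertex_cost expnS leq_mul2l ltn_expl. Qed.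

(** Write [a j] for the size of the ball of radius [j].  A vertex [x] of layer
[k.+1] has no neighbour within distance [k.-1] of [v], so
[deg x + 1 <= a k.+2 - a k.-1]: the costs of the vertices met while descending
to [v] telescope to three consecutive sizes.  Here [a (-1)] is 0, whence the
case distinction in the exponent. *)
Lemma ball_linked v k x : x \in ball v k ->
  linked (2 ^ (#|ball v k.+1| + #|ball v k| + (if k is j.+1 then #|ball v j| else 0))) x v.
Proof.
elim: k x => [|k IH] x.
  rewrite inE => /eqP ->; apply: linked_le (linked_refl v).
  apply: leq_trans (vertex_cost_le_exp v) _; rewrite leq_exp2l //.
  rewrite -addnA; apply: leq_trans (leq_addr _ _).
  rewrite -card_closed_nbhd //; apply: subset_leq_card.
  by apply: closed_nbhd_sub_ball; rewrite inE.
move=> xk1; have le1 := subset_leq_card (ball_subS v k).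
have le2 := subset_leq_card (ball_subS v k.+1).
have [xk|xk] := boolP (x \in ball v k).
  apply: linked_le (IH _ xk); rewrite leq_exp2l //.
  case: k {IH xk1 xk} le1 le2 => [|k] le1 le2; first lia.
  have le0 := subset_leq_card (ball_subS v k); lia.
have [y yk xy] := ball_succ xk1.
have {}xy : e x y by case/orP: xy => // /eqP E; rewrite E yk in xk.
apply: linked_le (linked_step xy (IH y yk)).
apply: (@leq_trans (2 ^ (deg e x).+1 * 2 ^ (#|ball v k.+1| + #|ball v k| +
    (if k is j.+1 then #|ball v j| else 0)))).
  by rewrite leq_mul2r vertex_cost_le_exp orbT.
rewrite -expnD leq_exp2l //.
suff : (deg e x).+1 + (if k is j.+1 then #|ball v j| else 0) <= #|ball v k.+2| by lia.
have sub2 := closed_nbhd_sub_ball xk1.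
rewrite -card_closed_nbhd //; case: k {IH le1} le2 xk1 xk yk sub2 => [|k] le2 xk1 xk yk sub2.
  by rewrite addn0 subset_leq_card.
have disj : closed_nbhd e x :&: ball v k = set0.
  apply/eqP; rewrite setI_eq0 -disjoint_sym; apply/pred0P => z /=.
  apply/negP => /andP[zk zx]; case/negP: xk.
  apply: (subsetP (closed_nbhd_sub_ball zk)).
  by move: zx; rewrite !inE sym_e eq_sym.
rewrite -cardsUI disj cards0 addn0; apply: subset_leq_card.
rewrite subUset sub2 /=.
by do 2![apply: subset_trans (ball_subS _ _) _]; exact: ball_subS.
Qed.

Lemma vertex_cost_le_card x m : #|T| <= m ^ 2 -> cost x <= 2 ^ (2 * m).+1.
Proof.
move=> Tm; rewrite expnS leq_mul2l /= -card_closed_nbhd //.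
apply: leq_trans (max_card _) (leq_trans Tm _).
by rewrite mulnC expnM leq_exp2r // ltnW // ltn_expl.
Qed.

Lemma ball_succ_linked v k c x m : #|T| <= m ^ 2 ->
  (forall y, y \in ball v k -> linked c y v) ->
  x \in ball v k.+1 -> linked (2 ^ (2 * m).+1 * c) x v.
Proof.
move=> Tm kc /ball_succ[y yk /predU1P[->|xy]].
  by apply: linked_le (kc y yk); rewrite leq_pmull ?expn_gt0.
apply: linked_le (linked_step xy (kc y yk)).
by rewrite leq_mul2r vertex_cost_le_card ?orbT.
Qed.

(** With [k] the least radius of a ball having [m] vertices, the ball of radius
[k.-1] has fewer than [m], so [ball_linked] links the ball of radius [k.-2] at
cost [2 ^ O(m)].  The last two layers may contain vertices of large degree, and
are reached by two single steps at the crude cost of [vertex_cost_le_card]. *)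
Lemma cluster v m : connected_graph e -> 0 < m <= #|T| -> #|T| <= m ^ 2 ->
  exists2 F : {set T}, m <= #|F| & forall x, x \in F -> linked (2 ^ (12 * m)) x v.
Proof.
move=> conn /andP[m0 mT] Tm.
have exk : exists k, m <= #|ball v k|.
  by exists #|T|; rewrite connected_ball // cardsT.
case: (ex_minnP exk) => k mk mink; exists (ball v k) => // x xk.
have inner y : y \in ball v k.-2 -> linked (2 ^ (5 * m).+1) y v.
  move=> yk; case: k mink {mk x xk} yk => [|[|[|k]]] mink yk.
  1-3: move: yk; rewrite inE => /eqP ->; apply: linked_le (linked_refl v).
  1-3: by apply: leq_trans (vertex_cost_le_card v Tm) _; rewrite leq_exp2l //; lia.
  apply: linked_le (ball_linked yk); rewrite leq_exp2l //=.
  have small : #|ball v k.+2| < m.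
    by rewrite ltnNge; apply/negP => /mink; rewrite ltnn.
  have le1 := subset_leq_card (ball_subS v k.+1).
  have le0 := subset_leq_card (ball_subS v k).
  move: (#|ball v k.+2|) (#|ball v k.+1|) (#|ball v k|) small le1 le0 => a b d; lia.
have xk2 : x \in ball v k.-2.+2.
  case: k xk {mk mink inner} => [|[|k]] // xk.
    by apply/(subsetP (ball_subS v 1))/(subsetP (ball_subS v 0)).
  exact: (subsetP (ball_subS v 1)).
have := @ball_succ_linked v k.-2.+1 _ x m Tm (fun y => @ball_succ_linked v k.-2 _ y m Tm inner) xk2.
by apply: linked_le; rewrite -!expnD leq_exp2l //; lia.
Qed.

End Links.

Lemma linked_set (T : finType) (e : rel T) m : symmetric e -> irreflexive e ->
  connected_graph e -> (0 < m <= #|T|)%N -> (#|T| <= m ^ 2)%N ->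
  exists2 S : {set T}, (#|S| <= m)%N &
    forall v, exists2 s, s \in S & linked e (2 ^ (24 * m)) v s.
Proof.
move=> sym_e irr_e conn mT Tm.
have /choice[F FP] : forall v, exists F : {set T}, (m <= #|F|)%N /\
    forall x, x \in F -> linked e (2 ^ (12 * m)) x v.
  move=> v; have [F mF FP] := @cluster _ _ sym_e irr_e v m conn mT Tm.
  by exists F.
have m0 : (0 < m)%N by case/andP: mT.
have [S Sm SP] := packing m0 (fun v => proj1 (FP v)).
exists S; first by rewrite -(leq_pmul2r m0) (leq_trans Sm) // mulnn.
move=> v; have [s sS /pred0Pn[x /andP[xv xs]]] := SP v; exists s => //.
apply: (linked_le (c := 2 ^ (12 * m) * 2 ^ (12 * m))).
  by rewrite -expnD leq_exp2l //; lia.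
apply: linked_trans (proj2 (FP s) _ xs).
by apply: linked_sym => //; exact: (proj2 (FP v)).
Qed.

Lemma sqrt_ceil n : (0 < n)%N ->
  exists m, [/\ (0 < m <= n)%N, (n <= m ^ 2)%N & (m.-1 ^ 2 <= n)%N].
Proof.
move=> n0; have exm : exists m, (n <= m ^ 2)%N by exists n; rewrite -mulnn leq_pmull.
case: (ex_minnP exm) => m nm minm; exists m; split => //.
  rewrite lt0n minm ?andbT; last by rewrite -mulnn leq_pmull.
  by apply: contraTneq nm => ->; rewrite -ltnNge.
case: m nm minm => [|m] nm minm //=; apply/ltnW; rewrite ltnNge.
by apply/negP => /minm; rewrite ltnn.
Qed.

(** * The throttling bound *)

Theorem theorem1p2 (R : realType) :
  exists2 K : R, 0 < K &
    forall (n : nat) (T : finType) (e : rel T),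
      (1 <= n)%N -> #|T| = n ->
      symmetric e -> irreflexive e -> connected_graph e ->
      (th_pzf R e <= (K * Num.sqrt n%:R)%:E)%E.
Proof.
(* The time bound is [(80 / 3) * (27 m) = 720 m], to which [#|S| <= m] is added;
   the number [m] is at most twice the square root. *)
exists 1442 => [|n T e n0 Tn sym_e irr_e conn]; first by rewrite ltr0n.
have [m [mn nm m1n]] := sqrt_ceil n0; have m0 : (0 < m)%N by case/andP: mn.
rewrite -Tn in mn nm m1n *.
have [S Sm SP] := linked_set sym_e irr_e conn mn nm.
have /choice[q qP] : forall v, exists q, [/\ path e v q, last v q \in S &
    (\prod_(w <- q) vertex_cost e w <= 2 ^ (24 * m))%N].
  move=> v; have [s sS [q [vq qs qc]]] := SP v; exists q; rewrite qs; split => //.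
  by apply: leq_trans qc; rewrite big_cons leq_pmull.
have S0 : S != set0.
  have /card_gt0P[v _] : (0 < #|T|)%N by rewrite Tn.
  by apply/set0Pn; have [s sS _] := SP v; exists s.
apply: (@le_trans _ _ (#|S|%:R%:E + ept R e S)%E).
  exact: (@bigmin_le_cond _ _ _ +oo%E S (fun S => S != set0)
    (fun S => #|S|%:R%:E + ept R e S)%E S0).
have := ept_le_paths R irr_e sym_e (fun v => let: And3 p _ _ := qP v in p)
  (fun v => let: And3 _ l _ := qP v in l) (fun v => let: And3 _ _ c := qP v in c).
move=> eptS; apply: le_trans (leeD2l _ eptS) _.
rewrite -EFinD lee_fin.
have lnc : ln (1 + #|T|%:R * (2 ^ (24 * m))%N%:R) <= (27 * m)%:R :> R.
  apply: (@le_trans _ _ (ln ((2 ^ (27 * m))%N%:R : R))).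
    rewrite ler_ln ?posrE ?ltr0n ?expn_gt0 // ?ltr_wpDr ?mulr_ge0 //.
    rewrite -natrM -[1]/(1%:R) -natrD ler_nat.
    have T2 : (#|T| <= 2 ^ (2 * m))%N.
      by apply: leq_trans nm _; rewrite mulnC expnM leq_exp2r // ltnW // ltn_expl.
    apply: (@leq_trans (2 ^ (26 * m) + 2 ^ (26 * m))).
      rewrite leq_add ?expn_gt0 // (leq_trans (leq_mul T2 (leqnn _))) //.
      by rewrite -expnD leq_exp2l //; lia.
    by rewrite addnn -muln2 -expnSr leq_exp2l //; lia.
  rewrite natrX lnXn // -[leLHS]mulr_natl ler_piMr //.
  by have := @le_ln1Dx R 1; rewrite (_ : 1 + 1 = 2) //; apply; lra.
have Sm' : #|S|%:R <= m%:R :> R by rewrite ler_nat.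
have mE : m%:R = m.-1%:R + 1 :> R by rewrite natr1 prednK.
have m1 : m.-1%:R <= Num.sqrt #|T|%:R :> R.
  by rewrite -[leLHS]ger0_norm // -sqrtr_sqr ler_wsqrtr // -natrX ler_nat.
have s1 : 1 <= Num.sqrt #|T|%:R :> R.
  by rewrite -[leLHS]sqrtr1 ler_wsqrtr // ler1n Tn.
rewrite natrM in lnc; lra.
Qed.
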